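(* Let $\mathbf{M}$ be a nonsingular $n\times n$ integer matrix with $(n-1)$th determinantal divisor $d_{n-1}$ and $m=|\det\mathbf{M}|$. Let $A=\{\mathbf{a}_1,\mathbf{a}_2\}$ be a generating set of the group $\mathbb{Z}^n/\mathbf{M}\mathbb{Z}^n$. Then: (i) the (strongly connected) multidimensional 2-step circulant digraph $G(\mathbf{M};A)$ is a circulant if and only if either (a) $d_{n-1}=1$, or (b) $d_{n-1}=2$ and $m=2\gcd\big(m,\gcd(m\mathbf{M}^{-1}(\mathbf{a}_1-\mathbf{a}_2))\big)$; (ii) the (connected) multidimensional circulant graph $G(\mathbf{M};\pm A)$ is a circulant if and only if (a) holds, or (b) holds, or (c) $d_{n-1}=2$ and $m=2\gcd\big(m,\gcd(m\mathbf{M}^{-1}(\mathbf{a}_1+\mathbf{a}_2))\big)$.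
   Context: For nonsingular $\mathbf{M}\in\mathbb{Z}^{n\times n}$, $\mathbb{Z}^n/\mathbf{M}\mathbb{Z}^n$ is the quotient of $\mathbb{Z}^n$ by the lattice spanned by the columns of $\mathbf{M}$ (a finite abelian group of order $m$). For $A\subseteq\mathbb{Z}^n/\mathbf{M}\mathbb{Z}^n$, the multidimensional circulant digraph $G(\mathbf{M};A)$ has vertex set $\mathbb{Z}^n/\mathbf{M}\mathbb{Z}^n$ and arcs $\mathbf{u}\to\mathbf{u}+\mathbf{a}\pmod{\mathbf{M}}$, $\mathbf{a}\in A$; $G(\mathbf{M};\pm A)$ denotes the graph obtained with the symmetric set $\pm A=A\cup(-A)$. A circulant is a (di)graph isomorphic to a Cayley (di)graph $G(m';B)$ of a cyclic group $\mathbb{Z}/m'\mathbb{Z}$ (vertex $u$ adjacent to $u+b\bmod m'$, $b\in B$). The $k$th determinantal divisor $d_k$ of $\mathbf{M}$ is the gcd of all $k\times k$ minors of $\mathbf{M}$. Here $m\mathbf{M}^{-1}$ is an integer matrix, and for an integer vector $\mathbf{v}$, $\gcd(\mathbf{v})$ denotes the gcd of its coordinates; vectors $\mathbf{a}_i$ are any integer representatives of their classes. *)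

(* Defs.v *)
From HB Require Import structures.
From mathcomp Require Import all_boot all_order all_algebra.
From mathcomp Require Import boolp.

Set Implicit Arguments.
Unset Strict Implicit.
Unset Printing Implicit Defensive.

Import GRing.Theory Num.Theory.

Local Open Scope ring_scope.
Local Open Scope quotient_scope.

Section CayleyDigraphs.

Definition cayley (V : zmodType) (A : {pred V}) (u v : V) : Prop :=
  exists2 a, a \in A & v = u + a.

Definition symmetrize (V : zmodType) (A : {pred V}) : {pred V} :=
  [pred x | (x \in A) || (- x \in A)].

Definition digraph_iso (V W : Type) (e : V -> V -> Prop) (f : W -> W -> Prop) :=
  exists2 phi : V -> W, bijective phi & forall u v, e u v <-> f (phi u) (phi v).

(* The cyclic group of order m' >= 1 is ['I_k.+1] with [m' = k.+1], whose
   canonical zmodType structure is addition modulo [k.+1].  ['Z_m'] would be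
   wrong here for [m' = 1]. *)
Definition is_circulant (V : Type) (e : V -> V -> Prop) :=
  exists (k : nat) (B : {pred 'I_k.+1}), digraph_iso e (cayley B).

Definition generates (V : zmodType) (A : {pred V}) :=
  forall H : zmodClosed V, {subset A <= H} -> forall x, x \in H.

End CayleyDigraphs.

Section LatticeQuotient.
Variables (n : nat) (M : 'M[int]_n).

Definition lattice : {pred 'cV[int]_n} := fun v => `[< exists w, v = M *m w >].

Fact lattice_zmod_closed : zmod_closed lattice.
Proof.
split=> [|u v /asboolP[x ->] /asboolP[y ->]]; apply/asboolP.
  by exists 0; rewrite mulmx0.
by exists (x - y); rewrite mulmxBr.
Qed.

HB.instance Definition _ :=
  GRing.isZmodClosed.Build 'cV[int]_n lattice lattice_zmod_closed.

Definition lattice_class (v : 'cV[int]_n) : Quotient.quot lattice :=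
  \pi_(Quotient.quot lattice) v.

End LatticeQuotient.

Section IntegerMatrices.
Variable n : nat.

Definition increasing k (f : {ffun 'I_k -> 'I_n}) :=
  [forall i : 'I_k, forall j : 'I_k, (i < j)%N ==> (f i < f j)%N].

Definition determinantal_divisor (k : nat) (M : 'M[int]_n) : nat :=
  \big[gcdn/0%N]_(f : {ffun 'I_k -> 'I_n} | increasing f)
    \big[gcdn/0%N]_(g : {ffun 'I_k -> 'I_n} | increasing g)
      `|\det (mxsub f g M)|%N.

Definition gcd_vec (v : 'cV[int]_n) : nat := \big[gcdn/0%N]_i `|v i 0%R|%N.

(* [m * M^-1] is computed over the rationals; its entries are integers when
   [M] is nonsingular ([scaled_invmxE]), so that taking numerators is the
   identification of integral rationals with integers. *)
Definition scaled_invmx (M : 'M[int]_n) : 'M[int]_n :=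
  map_mx numq (`|\det M|%:~R *: invmx (map_mx intr M)).

Fact scaled_invmxE (M : 'M[int]_n) : \det M != 0 ->
  map_mx intr (scaled_invmx M)
    = `|\det M|%:~R *: invmx (map_mx intr M) :> 'M[rat]_n.
Proof.
move=> dM; set d := (\det M)%:~R : rat.
have d0 : d != 0 by rewrite intr_eq0.
have e : `|\det M|%:~R *: invmx (map_mx intr M)
    = map_mx intr (sgz (\det M) *: \adj M) :> 'M[rat]_n.
  rewrite /invmx unitmxE det_map_mx unitfE d0 scalerA -map_mx_adj map_mxZ.
  congr (_ *: _).
  by rewrite -abszE abszEsg intrM -mulrA divff ?mulr1.
by rewrite /scaled_invmx e; apply/matrixP=> i j; rewrite !mxE numq_int.
Qed.

End IntegerMatrices.

(* Main.v *)
Require Import Defs.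
From HB Require Import structures.
From mathcomp Require Import all_boot all_order all_algebra.
From mathcomp Require Import boolp zify.

(** Write V for the quotient group, x and y for its two generators.  Since the
    gcd d of the entries of the adjugate of M is d_(n-1), the exponent of V is
    m / d, and |V| = m by the Smith normal form; hence V is cyclic iff d = 1,
    and (b), (c) say that d = 2 and that x - y, resp. x + y, has order 2.

    If z has order 2 and the connection set is a union of cosets of <z>, the
    Cayley digraph is the blow-up by 2 of a Cayley digraph of V/<z>; when x
    generates V modulo z this is a circulant.

    Conversely suppose that V is not cyclic and that x + x differs from y + y
    (and from - y - y in the undirected case).  An isomorphism phi onto a Cayley
    digraph of a cyclic group W must preserve squares: u + s and u + t have no
    common neighbours other than u and u + s + t, so
    phi (u + s + t) = phi (u + s) + phi (u + t) - phi u for s <> - t.  In the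
    undirected case one needs in addition that phi preserves antipodal pairs of
    edges u + s, u - s; a failure would produce two distinct involutions in W.
    Thus phi is affine and V is isomorphic to W, a contradiction. *)

Set Implicit Arguments.
Unset Strict Implicit.
Unset Printing Implicit Defensive.

Import Order.TTheory GRing.Theory Num.Theory.

Local Open Scope ring_scope.

(** * Linear arithmetic in abelian groups *)

(* [ring] does not apply to a bare [zmodType], so identities are decided by
   comparing the coefficients of reified terms. *)
Inductive zterm :=
  | ZVar of nat | ZZero | ZAdd of zterm & zterm | ZOpp of zterm.

Fixpoint zval (V : zmodType) (e : seq V) (t : zterm) : V :=
  match t with
  | ZVar i => e`_i
  | ZZero => 0
  | ZAdd t1 t2 => zval e t1 + zval e t2
  | ZOpp t1 => - zval e t1
  end.

Fixpoint zcoef (t : zterm) (i : nat) : int :=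
  match t with
  | ZVar j => (i == j)%:Z
  | ZZero => 0
  | ZAdd t1 t2 => zcoef t1 i + zcoef t2 i
  | ZOpp t1 => - zcoef t1 i
  end.

Lemma zval_coef (V : zmodType) (e : seq V) t :
  zval e t = \sum_(i < size e) e`_i *~ zcoef t i.
Proof.
elim: t => [j||t1 IH1 t2 IH2|t1 IH1] /=.
- have [lt_j|le_j] := ltnP j (size e); last first.
    (* An index beyond the end of the list denotes 0, the default of [nth], and its coefficient is
       never summed. *)
    rewrite nth_default // big1 // => i _; rewrite ltn_eqF ?mulr0z //.
    exact: leq_trans le_j.
  rewrite (bigD1 (Ordinal lt_j)) //= eqxx big1 ?addr0 // => i.
  by rewrite -val_eqE /= => /negPf ->.
- by rewrite big1 // => i _; rewrite mulr0z.
- by rewrite IH1 IH2 -big_split; apply: eq_bigr => i _; rewrite mulrzDr.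
- by rewrite IH1 -sumrN; apply: eq_bigr => i _; rewrite mulrNz.
Qed.

Lemma zval_eq (V : zmodType) (e : seq V) t1 t2 :
  all (fun i => zcoef t1 i == zcoef t2 i) (iota 0 (size e)) ->
  zval e t1 = zval e t2.
Proof.
move=> /allP e12; rewrite !zval_coef; apply: eq_bigr => i _.
have /e12/eqP -> // : (i : nat) \in iota 0 (size e) by rewrite mem_iota /=.
Qed.

Lemma eq_from_sub (V : zmodType) (a b c d : V) :
  c = d -> a - b = c - d -> a = b.
Proof. by move=> -> /eqP; rewrite subrr subr_eq0 => /eqP. Qed.

Lemma eq_add (V : zmodType) (a b c d : V) : a = b -> c = d -> a + c = b + d.
Proof. by move=> -> ->. Qed.

(** Atoms are identified by unification; [match goal] serves to run the tactic [unify] inside a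
    tactic that returns a term. *)
Ltac zindex x e :=
  match e with
  | ?y :: _ => let _ := match goal with _ => unify x y end in constr:(0%N)
  | _ :: ?e' => let i := zindex x e' in constr:(i.+1)
  end.
Ltac zadd_atom x e :=
  match e with
  | _ => let _ := zindex x e in e
  | _ => constr:(x :: e)
  end.
Ltac zatoms t e :=
  lazymatch t with
  | ?a + ?b => let e' := zatoms a e in zatoms b e'
  | - ?a => zatoms a e
  | 0 => e
  | _ => zadd_atom t e
  end.
Ltac zquote t e :=
  lazymatch t with
  | ?a + ?b => let a' := zquote a e in let b' := zquote b e in
      constr:(ZAdd a' b')
  | - ?a => let a' := zquote a e in constr:(ZOpp a')
  | 0 => constr:(ZZero)
  | _ => let i := zindex t e in constr:(ZVar i)
  end.
Ltac zmod :=
  lazymatch goal with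
  | |- @eq ?V ?a ?b =>
    let e1 := zatoms a constr:(@nil V) in
    let e := zatoms b e1 in
    let a' := zquote a e in
    let b' := zquote b e in
    exact (@zval_eq _ e a' b' isT)
  end.
(* [zlin h] proves [a = b] when [a - b] is plus or minus the difference of the
   two sides of [h]; [zlin h1 h2] does it for [h1] plus or minus [h2]. *)
Tactic Notation "zlin" constr(h) :=
  first [ apply: (eq_from_sub h); zmod | apply: (eq_from_sub (esym h)); zmod ].
Tactic Notation "zlin" constr(h1) constr(h2) :=
  first [ zlin (eq_add h1 h2) | zlin (eq_add h1 (esym h2)) ].

(** * Maps that are affine along a generating set *)

Lemma generates_ind (V : zmodType) (A : {pred V}) (P : V -> Prop) :
    generates A -> P 0 -> (forall u v, P u -> P v -> P (u - v)) ->
  (forall a, a \in A -> P a) -> forall v, P v.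
Proof.
move=> genA P0 PB PA v.
(* The elements satisfying [P] form a subgroup, turned classically into a boolean predicate so that
   [generates] applies. *)
pose H : {pred V} := fun x => `[< P x >].
have Hclosed : zmod_closed H.
  split=> [|x y /asboolP Px /asboolP Py]; apply/asboolP => //; exact: PB.
pose H' : zmodClosed V := HB.pack H (GRing.isZmodClosed.Build V H Hclosed).
have /asboolP // : v \in H'.
by apply: genA => x /PA Px; apply/asboolP.
Qed.

(** The hypothesis says that the increment of [phi] along a generator [s] is unchanged by
    translation by a generator [t]. Induction extends this first to all translations ([K]), then to
    all increments. *)
Lemma parallelogram_affine (V W : zmodType) (S : {pred V}) (phi : V -> W) :
    generates S ->
    (forall u s t, s \in S -> t \in S ->
       phi (u + s + t) = phi (u + s) + phi (u + t) - phi u) ->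
  forall u v, phi (u + v) = phi u + phi v - phi 0.
Proof.
move=> genS par.
have K g : forall u s, s \in S ->
    phi (u + g + s) - phi (u + g) = phi (u + s) - phi u.
  move: g; apply: (generates_ind genS) => [u s _|g h Kg Kh u s sS|g gS u s sS].
  - by rewrite addr0.
  - have := Kh (u + (g - h)) s sS; rewrite -addrA.
    have -> : u + (g - h) + (h + s) = u + g + s by zmod.
    have -> : u + (g - h) + h = u + g by zmod.
    by move=> <-; apply: Kg.
  - by rewrite par //; zmod.
move=> u v; move: v u; apply: (generates_ind genS) => [u|g h Kg Kh|g gS u].
- by rewrite addr0; zmod.
- have Q u : phi (u + (g - h)) = phi u + phi g - phi h.
    have := Kh (u + (g - h)).
    have -> : u + (g - h) + h = u + g by zmod.
    by rewrite Kg => e; zlin (esym e).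
  by move=> u; rewrite Q; move: (Q 0); rewrite add0r => ->; zmod.
- have := K u 0 g gS; rewrite !add0r => e; zlin e.
Qed.

(** * Rigidity of isomorphisms of Cayley digraphs *)

Section Rigidity.
Variables (V W : zmodType) (S : {pred V}) (B : {pred W}) (phi : V -> W).
Hypothesis phi_bij : bijective phi.
Hypothesis phi_arc : forall u v, cayley S u v <-> cayley B (phi u) (phi v).

Let phi_inj : injective phi := bij_inj phi_bij.

Lemma step_fwd u s : s \in S -> exists2 b, b \in B & phi (u + s) = phi u + b.
Proof. by move=> sS; apply/phi_arc; exists s. Qed.

Lemma step_bwd u b : b \in B -> exists2 s, s \in S & phi u + b = phi (u + s).
Proof.
move=> bB; have [psi _ phiK] := phi_bij.
have /phi_arc[s sS e] : cayley B (phi u) (phi (psi (phi u + b))).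
  by rewrite phiK; exists b.
by exists s => //; rewrite -e phiK.
Qed.

(** Completing the images of [u + x] and [u + y] to a parallelogram gives a common out-neighbour,
    whose preimage can only be [u + x + y]. A repeated step is then settled by elimination: with the
    label of the other generator it would collide with [u + x + y]. *)
Lemma two_step_rigidity x y : S =i [:: x; y] -> x + x <> y + y ->
  forall u s t, s \in S -> t \in S ->
    phi (u + s + t) = phi (u + s) + phi (u + t) - phi u.
Proof.
move=> Sxy xy2.
have xS : x \in S by rewrite Sxy !inE eqxx.
have yS : y \in S by rewrite Sxy !inE eqxx orbT.
have caseS s : s \in S -> s = x \/ s = y.
  by rewrite Sxy !inE => /orP[] /eqP; [left | right].
have par u : phi (u + (x + y)) = phi (u + x) + phi (u + y) - phi u.
  have [b bB eb] := step_fwd u xS; have [c cB ec] := step_fwd u yS.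
  have [p pS ep] := step_bwd (u + x) cB; have [q qS eq] := step_bwd (u + y) bB.
  have /phi_inj e : phi (u + x + p) = phi (u + y + q).
    by rewrite -ep -eq eb ec; zmod.
  have <- : u + x + p = u + (x + y); last by rewrite -ep eb ec; zmod.
  (* Only [p = x], [q = y] could miss the intended vertex, and it would force [x + x = y + y]. *)
  case: (caseS p pS) (caseS q qS) => ep' [] eq'; rewrite ep' eq' in e *; try zmod.
  - by zlin e.
  - by case: xy2; zlin e.
move=> u s t /caseS[] -> /caseS[] ->; last 1 first.
- have [b bB eb] := step_fwd (u + y) yS.
  have [c cB ec] := step_fwd (u + y) xS.
  have [p pS ep] := step_fwd u yS; have [q qS eq] := step_fwd u xS.
  have [r /caseS[] er e] := step_bwd u bB.
    have exy : x + y = y + x by zmod.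
    have := par u; rewrite exy addrA => e1; rewrite er in e.
    have /phi_inj e2 : phi (u + y + y) = phi (u + y + x).
      by rewrite e1 eb -e; zmod.
    by case: xy2; zlin e2 e2.
  by rewrite eb -er -e; zmod.
- have [b bB eb] := step_fwd (u + x) xS.
  have [r /caseS[] er e] := step_bwd u bB; last first.
    have := par u; rewrite addrA => e1; rewrite er in e.
    have /phi_inj e2 : phi (u + x + x) = phi (u + x + y).
      by rewrite e1 eb -e; zmod.
    by case: xy2; zlin e2 e2.
  by rewrite eb -er -e; zmod.
- by rewrite -addrA par; zmod.
- by rewrite -addrA [y + x]addrC par; zmod.
Qed.

(** The undirected case rests on these conditions. [S_square] says that [u + s] and [u + t] have no
    common neighbours besides [u] and [u + s + t]. *)
Hypothesis S0 : 0 \notin S.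
Hypothesis SN : forall s, s \in S -> - s \in S.
Hypothesis W_involution : forall p q : W,
  p + p = 0 -> q + q = 0 -> p <> 0 -> q <> 0 -> p = q.
Hypothesis S_double : forall s t, s \in S -> t \in S -> s <> t -> s <> - t ->
  s + s <> t + t.
Hypothesis S_double_notin : forall s t, s \in S -> t \in S -> s <> t -> s <> - t ->
  s + s <> t.
Hypothesis S_square : forall s t p q, s \in S -> t \in S -> p \in S -> q \in S ->
  s <> t -> s <> - t -> s + p = t + q -> s + p = 0 \/ p = t.

Let B0 : 0 \notin B.
Proof.
apply/negP=> /(step_bwd 0)[s sS]; rewrite addr0 => /phi_inj e.
by move: S0; rewrite (_ : 0 = s) ?sS //; zlin e.
Qed.

Let BN b : b \in B -> - b \in B.
Proof.
case/(step_bwd 0) => s sS e; have [c cB ec] := step_fwd (0 + s) (SN sS).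
suff <- : c = - b by [].
have ss : 0 + s - s = 0 by zmod.
by rewrite ss in ec; zlin e ec.
Qed.

(* If the opposites [b], [- b] at [phi u] came from non-opposite [s], [s'] then
   [u + s + s'] would be sent to [phi u + (b + b)] with [b] of order 4: any other
   neighbour of [phi (u + s + s')] would yield a second square through [u]. *)
Lemma antipodal_step u s s' b r : s \in S -> s' \in S -> s <> s' -> s <> - s' ->
    phi (u + s) = phi u + b -> phi (u + s') = phi u - b ->
    phi (u + s + s') = phi (u + s) + r -> b \in B -> r \in B ->
  r = b.
Proof.
move=> sS s'S ss' sNs' eb eb' er bB rB.
have [//|/eqP rb] := eqVneq r b.
have [erN|/eqP rNb] := eqVneq r (- b).
  case: sNs'; have /phi_inj e : phi (u + s + s') = phi u.
    by rewrite er eb erN; zmod.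
  by zlin e.
have [s'' s''S es''] := step_bwd u rB.
have ss'' : s <> s''.
  by move=> e; case: rb; rewrite -e in es''; rewrite eb in es''; zlin es''.
have s's'' : s' <> s''.
  by move=> e; case: rNb; rewrite -e in es''; rewrite eb' in es''; zlin es''.
have [q qS eq] := step_bwd (u + s'') bB.
have /phi_inj e1 : phi (u + s + s') = phi (u + s'' + q).
  by rewrite -eq -es'' er eb; zmod.
have e2 : s + s' = s'' + q by zlin e1.
(* [s''] cannot be opposite to both [s] and [s'], so [S_square] applies to one of the two pairs. *)
have [e3|/eqP sNs''] := eqVneq s (- s'').
  have s'Ns'' : s' <> - s'' by rewrite -e3 => e; case: ss'.
  have e4 : s' + s = s'' + q by zlin e1.
  have [e5|//] := S_square s'S s''S sS qS s's'' s'Ns'' e4.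
  by case: sNs'; zlin e5.
have [e5|e5] := S_square sS s''S s'S qS ss'' sNs'' e2; last by [].
by case: sNs'; zlin e5.
Qed.

(** By [antipodal_step] the path through [u + s] adds [b] twice and the path through [u + s']
    subtracts it twice; both end at the same vertex. *)
Lemma antipodal_order4 u s s' b : s \in S -> s' \in S -> s <> s' -> s <> - s' ->
    phi (u + s) = phi u + b -> phi (u + s') = phi u - b -> b \in B ->
  [/\ b + b <> 0, b + b + (b + b) = 0 & phi (u + s + s') = phi u + (b + b)].
Proof.
move=> sS s'S ss' sNs' eb eb' bB.
have [r rB er] := step_fwd (u + s) s'S.
have [q qB eq] := step_fwd (u + s') sS.
have rb := antipodal_step sS s'S ss' sNs' eb eb' er bB rB.
have s's : s' <> s by move=> e; case: ss'.
have s'Ns : s' <> - s by move=> e; case: sNs'; rewrite e opprK.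
have eb2 : phi (u + s) = phi u - (- b) by rewrite opprK.
have qb := antipodal_step s'S sS s's s'Ns eb' eb2 eq (BN bB) qB.
rewrite rb eb in er; rewrite qb eb' in eq.
have exch : u + s' + s = u + s + s' by zmod.
rewrite exch in eq.
split; last by rewrite er; zmod.
  move=> b2; case: ss'.
  have /phi_inj e : phi (u + s) = phi (u + s') by rewrite eb eb'; zlin b2.
  by zlin e.
by zlin eq er.
Qed.

(* The opposite [- s] of [s] gives another [c] at [phi u] with [c + c = 0] or
   with [c] of order 4; uniqueness of the involution of [W] excludes both. *)
Lemma antipodal_opp u s s' b : s \in S -> s' \in S -> s <> s' -> s <> - s' ->
    phi (u + s) = phi u + b -> phi (u + s') = phi u - b -> b \in B ->
  - s = s.
Proof.
move=> sS s'S ss' sNs' eb eb' bB.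
have [//|/eqP Nss] := eqVneq (- s) s; exfalso.
have [b2 b4 ebb] := antipodal_order4 sS s'S ss' sNs' eb eb' bB.
have NsS := SN sS.
have [c cB ec] := step_fwd u NsS.
have [t tS et] := step_bwd u (BN cB).
have c0 : c <> 0 by move=> c0; move: B0; rewrite -c0 cB.
have cNb : c <> - b.
  move=> e; rewrite e -eb' in ec; move/phi_inj: ec => ec.
  by case: sNs'; zlin ec.
have bc : b <> c.
  move=> e; rewrite -e -eb in ec; move/phi_inj: ec => ec; case: Nss; zlin ec.
have [tE|/eqP tNs] := eqVneq t (- s).
  have cc : c + c = 0 by rewrite tE ec in et; zlin et.
  (* Both [c] and [b + b] are involutions, so [u - s] and [u + s + s'] have the same image and
     [s + s = - s']. *)
  have ecb : c = b + b by apply: W_involution.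
  have /phi_inj e : phi (u + s + s') = phi (u - s) by rewrite ebb ec ecb.
  have sNNs' : s <> - - s' by rewrite opprK.
  by apply: (S_double_notin sS (SN s'S) sNs' sNNs'); zlin e.
have [tE|/eqP ts] := eqVneq t s.
  by rewrite tE eb in et; case: cNb; zlin et.
have Nst : - s <> t by move=> e; case: tNs.
have NsNt : - s <> - t by move=> /oppr_inj e; case: ts.
have [c2 c4 _] := antipodal_order4 NsS tS Nst NsNt ec (esym et) cB.
(* Uniqueness is used twice: [b + b = c + c] makes [b - c] an involution, and then [b - c = b + b],
   that is [c = - b]. *)
have ebc : b + b = c + c by apply: W_involution.
have bc2 : b - c + (b - c) = 0 by zlin ebc.
have bc0 : b - c <> 0 by move=> e; case: bc; zlin e.
have e := W_involution bc2 b4 bc0 b2.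
by case: cNb; zlin e.
Qed.

(** Let [s'] be the step sent to [- b]. If it is neither [s] nor [- s], then [antipodal_opp] makes
    both [s] and [s'] equal to their opposites, against [S_double]. *)
Lemma antipodal u s b : s \in S -> b \in B -> phi (u + s) = phi u + b ->
  phi (u - s) = phi u - b.
Proof.
move=> sS bB eb; have [s' s'S /esym es'] := step_bwd u (BN bB).
have NsS := SN sS.
have [<- //|/eqP s'Ns] := eqVneq s' (- s).
have [Nss|/eqP Nss] := eqVneq (- s) s.
  have s's : s' <> s by rewrite -Nss.
  have eb' : phi (u + s) = phi u - - b by rewrite opprK.
  have Ns's' := antipodal_opp s'S sS s's s'Ns es' eb' (BN bB).
  case: (S_double sS s'S) => [e|e|]; [by case: s's|by case: s's; rewrite e|].
  have {2}<- := Nss; have {2}<- := Ns's'; zmod.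
have [e|/eqP s's] := eqVneq s' s; last first.
  have sNs' : s <> - s' by move=> e; case: s'Ns; rewrite e opprK.
  by case: Nss; apply: (antipodal_opp sS s'S _ sNs' eb es' bB) => e; case: s's.
(* In the case [s' = s] the label [b] is an involution. The label [c] of [- s] would then be a
   second one, or equal [b], or fall under [antipodal_opp]. *)
exfalso; have bb : b + b = 0 by rewrite e eb in es'; zlin es'.
have b0 : b <> 0 by move=> b0; move: B0; rewrite -b0 bB.
have [c cB ec] := step_fwd u NsS; have [t tS /esym et] := step_bwd u (BN cB).
have c0 : c <> 0 by move=> c0; move: B0; rewrite -c0 cB.
have bc : b <> c.
  by move=> e1; rewrite -e1 -eb in ec; move/phi_inj: ec => ec; case: Nss; zlin ec.
have [tE|/eqP tNs] := eqVneq t (- s).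
  have cc : c + c = 0 by rewrite tE ec in et; zlin et.
  by case: bc; apply: W_involution.
have [tE|/eqP ts] := eqVneq t s.
  by rewrite tE eb in et; case: bc; zlin bb et.
have Nst : - s <> t by move=> e1; case: tNs.
have NsNt : - s <> - t by move=> /oppr_inj e1; case: ts.
have e1 := antipodal_opp NsS tS Nst NsNt ec et cB.
by case: Nss; zlin e1.
Qed.

(** For [t = - s] this is [antipodal] at [u], for [t = s] it is [antipodal] at [u + s]. Otherwise
    the image square is completed and [S_square] identifies the preimage of its fourth vertex. *)
Lemma symmetric_rigidity u s t : s \in S -> t \in S ->
  phi (u + s + t) = phi (u + s) + phi (u + t) - phi u.
Proof.
move=> sS tS.
have [b bB eb] := step_fwd u sS; have [c cB ec] := step_fwd u tS.
have anti := antipodal sS bB eb.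
have [->|/eqP tNs] := eqVneq t (- s).
  have -> : u + s - s = u by zmod.
  by rewrite anti eb; zmod.
have [ets|/eqP ts] := eqVneq t s.
  have [d dB ed] := step_fwd (u + s) (SN sS).
  have := antipodal (SN sS) dB ed.
  have e0 : u + s - s = u by zmod.
  by rewrite opprK e0 in ed *; rewrite ets => ->; zlin ed.
have st : s <> t by move=> e; case: ts.
have sNt : s <> - t by move=> e; case: tNs; rewrite e opprK.
have [p pS ep] := step_bwd (u + s) cB; have [q qS eq] := step_bwd (u + t) bB.
have /phi_inj e : phi (u + s + p) = phi (u + t + q).
  by rewrite -ep -eq eb ec; zmod.
have spq : s + p = t + q by zlin e.
have [e1|pt] := S_square sS tS pS qS st sNt spq.
  case: tNs.
  (* A fourth vertex equal to [u] would mean [c = - b], hence [t = - s]. *)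
  have e2 : u + s + p = u by zlin e1.
  rewrite e2 eb in ep.
  have /phi_inj e3 : phi (u + t) = phi (u - s) by rewrite anti ec; zlin ep.
  by zlin e3.
by rewrite -{1}pt -ep eb ec; zmod.
Qed.

End Rigidity.

(** * Circulant constructions *)

Definition cyclic_zmod (V : zmodType) :=
  exists g : V, forall v, exists k : int, v = g *~ k.

Lemma inj_surj_bij (T U : Type) (f : T -> U) :
  injective f -> (forall v, exists u, f u = v) -> bijective f.
Proof. by move=> f_inj /choice[h hK]; exists h => // u; apply: f_inj. Qed.

Lemma cayleyE (V : zmodType) (S : {pred V}) u v : cayley S u v <-> v - u \in S.
Proof.
split=> [[a aS ->]|vuS]; first by have -> : u + a - u = a by zmod.
by exists (v - u) => //; zmod.
Qed.

Lemma mulrn_mod (V : zmodType) (g : V) k n : g *+ k = 0 -> g *+ (n %% k) = g *+ n.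
Proof.
by move=> gk; rewrite [in RHS](divn_eq n k) mulrnDr mulnC mulrnA gk mul0rn add0r.
Qed.

Lemma mulrn_ordB (V : zmodType) (g : V) k (u v : 'I_k.+1) : g *+ k.+1 = 0 ->
  g *+ (u - v)%R = g *+ u - g *+ v.
Proof.
move=> gk; rewrite /= mulrn_mod // mulrnDr mulrn_mod //; congr (_ + _).
by rewrite mulrnBr ?gk ?sub0r // ltnW.
Qed.

(** Only membership of differences is compared, so [f] may be a mere bijection; in this way a
    non-cyclic group can carry a circulant. *)
Lemma circulant_of_bij (V : zmodType) (S : {pred V}) k (f : 'I_k.+1 -> V)
    (B : {pred 'I_k.+1}) :
    bijective f -> (forall u v, f v - f u \in S <-> v - u \in B) ->
  is_circulant (cayley S).
Proof.
move=> [h fK hK] fB; exists k, B, h; first by exists f.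
move=> u v; apply: (iff_trans (cayleyE _ _ _)).
by apply: (iff_trans _ (iff_sym (cayleyE _ _ _))); rewrite -fB !hK.
Qed.

Lemma zorder (V : zmodType) (g : V) N : (0 < N)%N -> g *+ N = 0 ->
  exists k, g *+ k.+1 = 0 /\ forall n, g *+ n = 0 -> (k.+1 %| n)%N.
Proof.
move=> N0 gN; have exP : exists n, (0 < n)%N && (g *+ n == 0).
  by exists N; rewrite N0 gN eqxx.
case: (ex_minnP exP) => -[|k] // /andP[_ /eqP gk] kmin; exists k; split=> // n gn.
apply/negPn/negP=> nk; have : (0 < n %% k.+1)%N by rewrite lt0n.
move=> r0; have := kmin (n %% k.+1)%N; rewrite r0 mulrn_mod // gn eqxx => /(_ isT).
by rewrite leqNgt ltn_pmod.
Qed.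

Lemma mulrz_mod (V : zmodType) (g : V) k (i : int) : g *+ k.+1 = 0 ->
  exists2 r, (r < k.+1)%N & g *~ i = g *+ r.
Proof.
move=> gk; exists `|(i %% k.+1)%Z|%N; first by lia.
rewrite [in LHS](divz_eq i k.+1) mulrzDr mulrC mulrzA -pmulrn gk mul0rz add0r.
by rewrite pmulrn gez0_abs // modz_ge0.
Qed.

Lemma cyclic_bij (V : zmodType) N : (0 < N)%N -> (forall v : V, v *+ N = 0) ->
    cyclic_zmod V ->
  exists (g : V) k, g *+ k.+1 = 0 /\ bijective (fun u : 'I_k.+1 => g *+ u).
Proof.
move=> N0 VN [g gV]; have [k [gk kmin]] := zorder N0 (VN g).
exists g, k; split=> //; pose f (u : 'I_k.+1) := g *+ u.
have f_inj : injective f.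
  move=> u v /eqP; rewrite -subr_eq0 -mulrn_ordB // => /eqP /kmin.
  rewrite /dvdn modn_small // => /eqP e.
  by apply/eqP; rewrite -subr_eq0; apply/eqP; apply: val_inj.
have f_surj v : exists u, f u = v.
  have [i ->] := gV v; have [r rk ->] := mulrz_mod i gk.
  by exists (Ordinal rk).
exact: inj_surj_bij.
Qed.

Lemma cyclic_circulant (V : zmodType) (S : {pred V}) N :
    (0 < N)%N -> (forall v : V, v *+ N = 0) -> cyclic_zmod V ->
  is_circulant (cayley S).
Proof.
move=> N0 VN /(cyclic_bij N0 VN)[g [k [gk f_bij]]].
apply: (circulant_of_bij (B := [pred b : 'I_k.+1 | g *+ b \in S]) f_bij).
by move=> u v; rewrite -mulrn_ordB.
Qed.

(** [k.+1] is the order of [x] modulo [z]. Each element is uniquely [x *+ r + z *+ q] with [r <= k]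
    and [q < 2], and the index [q * k.+1 + r] encodes the pair. *)
Lemma involution_bij (V : zmodType) (x z : V) N : (0 < N)%N -> x *+ N = 0 ->
    z + z = 0 -> z <> 0 -> (forall v, exists i j : int, v = x *~ i + z *~ j) ->
  exists k, (x *+ k.+1 = 0 \/ x *+ k.+1 = z) /\
    bijective (fun u : 'I_(2 * k.+1) => x *+ (u %% k.+1) + z *+ (u %/ k.+1)).
Proof.
move=> N0 xN zz z0 gen; have exP : exists n, (0 < n)%N && (x *+ n \in [:: 0; z]).
  by exists N; rewrite N0 xN inE eqxx.
case: (ex_minnP exP) => -[|k] // /andP[_ xk] kmin; exists k; split.
  by move: xk; rewrite !inE => /orP[] /eqP; [left | right].
have zmulz (j : int) : z *~ j = 0 \/ z *~ j = z.
  have z2 : z *+ 2 = 0 by rewrite mulr2n.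
  have [[|[|//]] _ ->] := mulrz_mod j z2; first by left.
  by right; rewrite mulr1n.
(* By minimality of [k.+1], the multiples of [x] below it are distinct modulo [z]. *)
have small r r' : (r < k.+1)%N -> (r' <= r)%N ->
    x *+ r - x *+ r' \in [:: 0; z] -> r = r'.
  move=> rk; rewrite leq_eqVlt => /orP[/eqP //|r'r]; rewrite -mulrnBr 1?ltnW //.
  move=> e; have := kmin (r - r')%N; rewrite subn_gt0 r'r e => /(_ isT).
  by lia.
set f := (X in bijective X).
have f_inj : injective f.
  move=> u v; rewrite /f => e.
  have ur := ltn_pmod u (ltn0Sn k); have vr := ltn_pmod v (ltn0Sn k).
  have uq : (u %/ k.+1 < 2)%N by rewrite ltn_divLR // ltn_ord.
  have vq : (v %/ k.+1 < 2)%N by rewrite ltn_divLR // ltn_ord.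
  have er : (u %% k.+1 = v %% k.+1)%N.
    have := zmulz ((v %/ k.+1)%N%:Z - (u %/ k.+1)%N%:Z).
    rewrite mulrzBr -!pmulrn => ez.
    have := zmulz ((u %/ k.+1)%N%:Z - (v %/ k.+1)%N%:Z).
    rewrite mulrzBr -!pmulrn => ez'.
    have [le|/ltnW le] := leqP (v %% k.+1)%N (u %% k.+1)%N.
      apply: small => //; case: ez => {}ez; rewrite !inE; apply/orP;
        [left|right]; by apply/eqP; zlin e ez.
    apply/esym; apply: small => //; case: ez' => {}ez; rewrite !inE; apply/orP;
      [left|right]; by apply/eqP; zlin e ez.
  apply: val_inj; rewrite /= (divn_eq u k.+1) (divn_eq v k.+1) er.
  congr (_ * _ + _)%N; rewrite er in e; move/addrI: e.
  case: (u %/ k.+1)%N uq => [|[|//]] _; case: (v %/ k.+1)%N vq => [|[|//]] _ //;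
  by rewrite mulr1n mulr0n => e; case: z0.
have f_surj v : exists u, f u = v.
  have xV (i : int) : exists2 r, (r < k.+1)%N &
      exists j : int, x *~ i = x *+ r + z *~ j.
    have r0 : (`|(i %% k.+1)%Z| < k.+1)%N by lia.
    exists `|(i %% k.+1)%Z|%N => //.
    rewrite (pmulrn x) gez0_abs ?modz_ge0 //.
    rewrite [in X in exists j, X = _](divz_eq i k.+1) mulrzDr mulrC mulrzA -pmulrn.
    move: xk; rewrite !inE => /orP[] /eqP ->.
      by exists 0; rewrite mul0rz mulr0z add0r addr0.
    by exists (i %/ k.+1)%Z; rewrite addrC.
  have [i [j ->]] := gen v; have [r rk [j' ->]] := xV i.
  have -> : x *+ r + z *~ j' + z *~ j = x *+ r + z *~ (j' + j).
    by rewrite mulrzDr addrA.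
  have [q q2 ->] : exists2 q, (q < 2)%N & z *~ (j' + j) = z *+ q.
    by case: (zmulz (j' + j)) => ->; [exists 0%N | exists 1%N].
  have lt : (q * k.+1 + r < 2 * k.+1)%N by nia.
  exists (Ordinal lt); rewrite /f /= modnMDl modn_small // divnMDl //.
  by rewrite divn_small // addn0.
exact: inj_surj_bij.
Qed.

(** The bijection of [involution_bij] sends [u] to [x *+ u] up to a multiple of [z], which
    membership in [S] does not see. Hence the labels on the cyclic group of order [2 * k.+1] are the
    [b] with [x *+ b] in [S]. *)
Lemma involution_circulant (V : zmodType) (S : {pred V}) (x z : V) N :
    (0 < N)%N -> x *+ N = 0 -> z + z = 0 -> z <> 0 ->
    (forall v, exists i j : int, v = x *~ i + z *~ j) ->
    (forall s, s \in S -> s + z \in S) ->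
  is_circulant (cayley S).
Proof.
move=> N0 xN zz z0 gen Sz.
have [k [xk f_bij]] := involution_bij N0 xN zz z0 gen.
have SzE v q : (v + z *+ q \in S) = (v \in S).
  elim: q => [|q <-]; first by rewrite addr0.
  have e : v + z *+ q.+1 = v + z *+ q + z by rewrite mulrSr addrA.
  rewrite e; apply/idP/idP=> [/Sz|/Sz //]; by rewrite -addrA zz addr0.
have SzN v q : (v - z *+ q \in S) = (v \in S).
  by rewrite -[LHS](SzE _ q) subrK.
have xmod n : exists q, x *+ n = x *+ (n %% k.+1) + z *+ q.
  rewrite [in X in exists q, X = _](divn_eq n k.+1) mulrnDr mulnC mulrnA addrC.
  by case: xk => ->; [exists 0%N; rewrite mul0rn | exists (n %/ k.+1)%N].
(* This makes [x *+ b] well defined for [b] modulo [2 * k.+1]. *)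
have x2k : x *+ (2 * k.+1) = 0.
  rewrite mulnC mulrnA; case: xk => ->; [exact: mul0rn | by rewrite mulr2n].
(* [(2 * k.+1).-1.+1] is convertible to [2 * k.+1] and displays it as a successor. *)
apply: (circulant_of_bij (k := (2 * k.+1).-1)
  (B := [pred b : 'I_(2 * k.+1).-1.+1 | x *+ b \in S]) f_bij).
move=> u v; rewrite inE mulrn_ordB //.
have [q ->] := xmod u; have [r ->] := xmod v.
set a := x *+ _; set b := x *+ _.
by rewrite !opprD !addrA !SzN ![_ + _ - b]addrAC !SzE.
Qed.

(** * Involutions and affine bijections of cyclic groups *)

Lemma card_unique (V : Type) m n (f : 'I_m -> V) (g : 'I_n -> V) :
  bijective f -> bijective g -> m = n.
Proof.
move=> f_bij [h gK hK]; rewrite -[m]card_ord -[n]card_ord.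
by apply: (bij_eq_card (f := h \o f)); apply: bij_comp => //; exists g.
Qed.

(** An involution [r] satisfies [r + r = k.+1] as a natural number. *)
Lemma ord_involution k (p q : 'I_k.+1) :
  p + p = 0 -> q + q = 0 -> p <> 0 -> q <> 0 -> p = q.
Proof.
have half (r : 'I_k.+1) : r + r = 0 -> r <> 0 -> (r + r = k.+1)%N.
  move=> /(congr1 val) /= /eqP; rewrite -/(dvdn _ _) => /dvdnP[c e] r0.
  have r1 : (0 < r)%N by rewrite lt0n; apply/negP=> /eqP e0; apply/r0/val_inj.
  have := ltn_ord r; case: c e => [|[|c]] e; nia.
move=> /half hp /half hq /hp ep /hq eq; apply: val_inj => /=; lia.
Qed.

(** [phi - phi 0] is a group isomorphism, so the preimage of [phi 0 + Zp1] generates. *)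
Lemma affine_cyclic (V : zmodType) k (phi : V -> 'I_k.+1) : bijective phi ->
  (forall u v, phi (u + v) = phi u + phi v - phi 0) -> cyclic_zmod V.
Proof.
move=> [psi phiK psiK] affine; pose g := psi (phi 0 + Zp1); exists g => v.
have phi_gn n : phi (g *+ n) = phi 0 + Zp1 *+ n.
  elim: n => [|n IHn]; first by rewrite !mulr0n addr0.
  by rewrite !mulrS affine psiK IHn; zmod.
exists (phi v - phi 0 : 'I_k.+1)%R; rewrite -pmulrn; apply: (can_inj phiK).
have Zp1_mulrn (w : 'I_k.+1) : Zp1 *+ w = w.
  by rewrite Zp_mulrn; apply: val_inj; rewrite /= modnMml mul1n modn_small.
by rewrite phi_gn Zp1_mulrn; zmod.
Qed.

(** * Groups with two generators *)

Definition spans (V : zmodType) (x y : V) :=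
  forall v, exists i j : int, v = x *~ i + y *~ j.

Lemma generates_spans (V : zmodType) (x y : V) :
  generates (mem [:: x; y]) -> spans x y.
Proof.
move=> gen; apply: (generates_ind gen) => [|u v [i [j ->]] [i' [j' ->]]|a].
- by exists 0, 0; rewrite !mulr0z addr0.
- by exists (i - i'), (j - j'); rewrite !mulrzBr; zmod.
- rewrite !inE => /orP[] /eqP ->; [exists 1, 0 | exists 0, 1];
  by rewrite mulr0z mulr1z ?addr0 ?add0r.
Qed.

Lemma spansC (V : zmodType) (x y : V) : spans x y -> spans y x.
Proof. by move=> sp v; have [i [j ->]] := sp v; exists j, i; rewrite addrC. Qed.

Lemma spansN (V : zmodType) (x y : V) : spans x y -> spans x (- y).
Proof.
move=> sp v; have [i [j ->]] := sp v; exists i, (- j).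
by rewrite mulrNz mulNrz opprK.
Qed.

Lemma spansD (V : zmodType) (x y : V) : spans x y -> spans x (x + y).
Proof.
move=> sp v; have [i [j ->]] := sp v; exists (i - j), j.
by rewrite mulrzBr mulrzDl; zmod.
Qed.

Lemma spans_cyclic (V : zmodType) (x y : V) k : spans x y -> y = x *~ k ->
  cyclic_zmod V.
Proof.
move=> sp yE; exists x => v; have [i [j ->]] := sp v; exists (i + k * j).
by rewrite yE mulrzDr mulrzA.
Qed.

Section TwoGenerators.
Variables (V : zmodType) (x y : V) (m d : nat).
Hypothesis m_gt0 : (0 < m)%N.
Hypothesis gen : generates (mem [:: x; y]).
Hypothesis cardV : exists f : 'I_m -> V, bijective f.
Hypothesis d_dvd : (d %| m)%N.
(** In other words, the exponent of [V] is [m %/ d]. *)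
Hypothesis exponentV : forall k, (forall v : V, v *+ k = 0) <-> (m %| k * d)%N.
Hypothesis d1_cyclic : d = 1%N -> cyclic_zmod V.

Let sp : spans x y := generates_spans gen.

Let killV (v : V) : v *+ m = 0.
Proof. by have [_ ->] := exponentV m; rewrite ?dvdn_mulr. Qed.

Let killVd (v : V) : v *+ (m %/ d) = 0.
Proof. by have [_ ->] := exponentV (m %/ d); rewrite ?divnK. Qed.

(** A generator has order [m], but [m %/ d] kills it. *)
Lemma cyclic_d1 : cyclic_zmod V -> d = 1%N.
Proof.
move=> /(cyclic_bij m_gt0 killV)[g [k [gk f_bij]]].
have [h h_bij] := cardV; have mk := card_unique h_bij f_bij.
have : (k.+1 %| m %/ d)%N.
  rewrite /dvdn; apply/eqP; have k_gt0 := ltn_pmod (m %/ d) (ltn0Sn k).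
  have := bij_inj f_bij (x1 := Ordinal k_gt0) (x2 := ord0).
  by rewrite /= mulrn_mod // killVd mulr0n => /(_ erefl) /(congr1 val).
rewrite -mk => /dvdnP[c e]; have := divnK d_dvd; rewrite e => e'.
have : (c * d * m = m)%N by rewrite -[RHS]e'; lia.
move=> e2; have /eqP : (c * d = 1)%N by nia.
by rewrite muln_eq1 => /andP[_ /eqP].
Qed.

(** The order of [V] is [2 * k.+1] and, outside the cyclic case, its exponent is [k.+1]; comparison
    with [m %/ d] gives [d = 2]. *)
Lemma involution_d2 (u z : V) :
  spans u z -> z + z = 0 -> z <> 0 -> ~ cyclic_zmod V -> d = 2.
Proof.
move=> spz zz z0 ncyc.
have [k [uk f_bij]] := involution_bij m_gt0 (killV u) zz z0 spz.
have [h h_bij] := cardV; have mk := card_unique h_bij f_bij.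
have {}uk : u *+ k.+1 = 0.
  by case: uk => // e; case: ncyc; apply: (spans_cyclic spz (k := k.+1)).
have zn n : z *+ n = z *+ odd n.
  rewrite -[in LHS](odd_double_half n) mulrnDr -mul2n mulrnA [z *+ 2]mulr2n zz.
  by rewrite mul0rn addr0.
have k_even : ~~ odd k.+1.
  (* If [k.+1] were odd, [k.+1] times [u + z] would be [z], and [u + z] would generate. *)
  apply/negP=> k_odd; case: ncyc.
  apply: (@spans_cyclic _ (u + z) z k.+1).
    by move=> v; have [i [j ->]] := spz v; exists i, (j - i);
       rewrite mulrzBr mulrzDl; zmod.
  by rewrite -pmulrn mulrnDl uk zn k_odd add0r.
have d_even : (m %| k.+1 * d)%N.
  apply/exponentV=> v; have [i [j ->]] := spz v.
  rewrite mulrnDl !pmulrn ![_ *~ _ *~ k.+1]mulrzAC -!pmulrn uk zn (negPf k_even).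
  by rewrite mulr0n !mul0rz addr0.
have k_dvd : (k.+1 %| m %/ d)%N.
  rewrite /dvdn; apply/eqP; set r := ((m %/ d) %% k.+1)%N.
  have rk : (r < k.+1)%N by rewrite ltn_pmod.
  have rk2 : (r < 2 * k.+1)%N by lia.
  have := bij_inj f_bij (x1 := Ordinal rk2) (x2 := Ordinal (isT : 0 < 2 * k.+1)%N).
  rewrite /= !(modn_small rk) !(divn_small rk) mod0n div0n.
  by rewrite /r mulrn_mod // killVd mulr0n => /(_ erefl) /(congr1 val).
case/dvdnP: d_even => c e; case/dvdnP: k_dvd => q e'.
have := divnK d_dvd; rewrite e' => e''.
have qd : (q * d = 2)%N by nia.
have cd : (c * 2 = d)%N by nia.
have /eqP : (q * c = 1)%N by nia.
by rewrite muln_eq1 => /andP[_ /eqP c1]; lia.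
Qed.
(** Outside the cyclic case rigidity forces [x + x = y + y]. Then [x - y] is an involution, and
    translation by it exchanges [x] and [y]. *)
Lemma two_step_circulant :
  is_circulant (cayley (mem [:: x; y])) <->
  d = 1%N \/ (d = 2 /\ x - y + (x - y) = 0 /\ x - y <> 0).
Proof.
split=> [[k [B [phi phi_bij phi_arc]]]|].
  have [cyc|ncyc] := pselect (cyclic_zmod V); [left; exact: cyclic_d1|right].
  have xy0 : x - y <> 0.
    move=> e; case: ncyc; apply: (spans_cyclic (k := 1) sp); rewrite mulr1z.
    by zlin e.
  have spz : spans x (x - y) by apply/spansD/spansN.
  have [e|/eqP ne] := eqVneq (x + x) (y + y).
    have zz : x - y + (x - y) = 0 by zlin e.
    by split; [exact: involution_d2 spz zz xy0 ncyc | split].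
  case: ncyc; apply: (affine_cyclic phi_bij).
  apply: (parallelogram_affine gen).
  exact: (two_step_rigidity phi_bij phi_arc (x := x) (y := y)).
case=> [/d1_cyclic|[_ [zz z0]]]; first exact: cyclic_circulant m_gt0 killV.
apply: (involution_circulant (x := x) (z := x - y) m_gt0) => //.
  exact/spansD/spansN.
move=> s; rewrite !inE => /orP[] /eqP ->; apply/orP; [right|left]; apply/eqP.
  by zlin zz.
by zmod.
Qed.

Let S := symmetrize (mem [:: x; y]).

Let memS s : s \in S -> [\/ s = x, s = - x, s = y | s = - y].
Proof.
rewrite !inE => /orP[] /orP[] /eqP e; [exact: Or41|exact: Or43| |].
  by apply: Or42; rewrite -e opprK.
by apply: Or44; rewrite -e opprK.
Qed.

Let inS s : [\/ s = x, s = - x, s = y | s = - y] -> s \in S.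
Proof. by rewrite !inE => -[] ->; rewrite ?opprK eqxx ?orbT. Qed.

(** Such [s] and [t] are the two generators up to order and signs. With [spansS], this lets the
    hypotheses of [symmetric_rigidity] be checked on a generic pair. *)
Let memS2 s t p : s \in S -> t \in S -> s <> t -> s <> - t -> p \in S ->
  [\/ p = s, p = - s, p = t | p = - t].
Proof.
move=> /memS[] -> /memS[] -> st sNt; rewrite ?opprK // in st sNt *;
by move=> /memS[] ->; solve [exact: Or41 | exact: Or42 | exact: Or43 | exact: Or44].
Qed.

Let spansS s t : s \in S -> t \in S -> s <> t -> s <> - t -> spans s t.
Proof.
have spNl u v : spans u v -> spans (- u) v by move=> /spansC /spansN /spansC.
have spN := (@spansN V); have spC := spansC sp.
by move=> /memS[] -> /memS[] -> st sNt; rewrite ?opprK // in st sNt;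
  do ?[apply: spNl | apply: spN]; auto.
Qed.

Lemma symmetric_circulant :
  is_circulant (cayley (symmetrize (mem [:: x; y]))) <->
  [\/ d = 1%N, d = 2 /\ x - y + (x - y) = 0 /\ x - y <> 0
    | d = 2 /\ x + y + (x + y) = 0 /\ x + y <> 0].
Proof.
have spD : spans x (x + y) by exact/spansD.
have spB : spans x (x - y) by exact/spansD/spansN.
split=> [[k [B [phi phi_bij phi_arc]]]|].
  have [cyc|ncyc] := pselect (cyclic_zmod V).
    by apply: Or31; exact: cyclic_d1.
  have xBy0 : x - y <> 0.
    move=> e; case: ncyc; apply: (spans_cyclic (k := 1) sp); rewrite mulr1z.
    by zlin e.
  have xDy0 : x + y <> 0.
    move=> e; case: ncyc; apply: (spans_cyclic (k := - 1) sp).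
    by rewrite mulrNz mulr1z; zlin e.
  have [e|/eqP neB] := eqVneq (x + x) (y + y).
    have zz : x - y + (x - y) = 0 by zlin e.
    by apply: Or32; split; [exact: involution_d2 spB zz xBy0 ncyc | split].
  have [e|/eqP neD] := eqVneq (x + x) (- y - y).
    have zz : x + y + (x + y) = 0 by zlin e.
    by apply: Or33; split; [exact: involution_d2 spD zz xDy0 ncyc | split].
  (* As [s] and [t] span [V], it would be cyclic if [t] were a multiple of [s]; the multiples by 2
     and 3 occur below. *)
  have free s t (i : int) :
      s \in S -> t \in S -> s <> t -> s <> - t -> t <> s *~ i.
    by move=> sS tS st sNt e; apply/ncyc/(spans_cyclic (spansS sS tS st sNt) e).
  have SN s : s \in S -> - s \in S by rewrite !inE opprK orbC.
  have dbl s t : s \in S -> t \in S -> s <> t -> s <> - t -> s + s <> t + t.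
    by move=> /memS[] -> /memS[] -> st sNt e; rewrite ?opprK // in st sNt e;
      solve [apply: neB; zlin e | apply: neD; zlin e].
  exfalso; apply: (ncyc); apply: (affine_cyclic phi_bij).
  apply: (parallelogram_affine (S := S)).
    move=> H SH; apply: gen => s sS; apply: SH.
    by rewrite !inE in sS *; rewrite sS.
  apply: (symmetric_rigidity phi_bij phi_arc) => //; last 1 first.
  - move=> s t p q sS tS pS qS st sNt e.
    have ts : t <> s by move=> e'; case: st.
    have tNs : t <> - s by move=> e'; case: sNt; rewrite e' opprK.
    have st3 : t <> s + s + s 
      by move=> e'; apply: (free s t 3 sS tS st sNt); rewrite e' -addrA.
    have ts3 : s <> t + t + t 
      by move=> e'; apply: (free t s 3 tS sS ts tNs); rewrite e' -addrA.
    have st2 := dbl s t sS tS st sNt.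
    (* Each of the sixteen choices of [p] and [q] gives the conclusion or one of the excluded
       relations [t = 3 s], [s = 3 t], [2 s = 2 t]. *)
    case: (memS2 sS tS st sNt pS) => ep; rewrite ep in e *;
    case: (memS2 sS tS st sNt qS) => eq; rewrite eq in e;
    first [ by left; zmod | by right | by left; zlin e | by right; zlin e
          | exfalso ].
    + by apply: st3; zlin e.
    + by apply: st2; zlin e.
    + by apply: ts3; zlin e.
  - apply/negP=> /memS[] e; apply: ncyc;
    [apply: (spans_cyclic (k := 0) (spansC sp))
    |apply: (spans_cyclic (k := 0) (spansC sp))
    |apply: (spans_cyclic (k := 0) sp) | apply: (spans_cyclic (k := 0) sp)];
    by rewrite mulr0z; zlin e.
  - exact: ord_involution.
  - by move=> s t sS tS st sNt e; apply: (free s t 2 sS tS st sNt); rewrite -e.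
(* Translation by the involution [x - y] exchanges [x] with [y] and [- x] with [- y]; translation by
   [x + y] exchanges [x] with [- y] and [y] with [- x]. *)
move=> h; have [/d1_cyclic|zS] : d = 1%N \/ exists z,
    [/\ z + z = 0, z <> 0, spans x z & forall s, s \in S -> s + z \in S].
- case: h => [->|[_ [zz z0]]|[_ [zz z0]]]; [by left| |]; right;
  [exists (x - y)|exists (x + y)]; split=> // s /memS[] ->; apply: inS;
  solve [apply: Or41; first [zmod | zlin zz] | apply: Or42; first [zmod | zlin zz]
        |apply: Or43; first [zmod | zlin zz] | apply: Or44; first [zmod | zlin zz]].
- exact: cyclic_circulant m_gt0 killV.
case: zS => z [zz z0 spz Sz].
exact: involution_circulant m_gt0 (killV x) zz z0 spz Sz.
Qed.
End TwoGenerators.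

(** * The group Z^n / M Z^n *)

Lemma increasing_lift n (i : 'I_n.+1) : increasing [ffun j : 'I_n => lift i j].
Proof.
apply/forallP=> j; apply/forallP=> k; apply/implyP=> jk; rewrite !ffunE /=.
by rewrite ltnNge leq_bump2 -ltnNge.
Qed.

(** An increasing [f] misses exactly one value [i], and a strictly increasing list is determined by
    its set of entries. *)
Lemma increasingP n (f : {ffun 'I_n -> 'I_n.+1}) : increasing f ->
  exists i : 'I_n.+1, f = [ffun j => lift i j].
Proof.
move=> /forallP f_incr.
have f_lt (j k : 'I_n) : (j < k)%N -> (f j < f k)%N.
  by move=> jk; have /forallP/(_ k)/implyP := f_incr j; apply.
have f_inj : injective f.
  move=> j k e; apply/val_inj; case: (ltngtP j k) => // /f_lt;
  by rewrite e ltnn.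
have [i fi] : exists i, i \notin codom f.
  apply/existsP; rewrite -negb_forall; apply/negP=> /forallP f_surj.
  have : (#|'I_n.+1| <= #|codom f|)%N.
    by apply/subset_leq_card/subsetP=> j _; apply: f_surj.
  by rewrite card_codom // !card_ord ltnn.
exists i; apply/ffunP=> j; rewrite ffunE.
pose s1 := [seq val k | k <- codom f].
pose s2 := [seq val k | k <- codom (lift i)].
have sorted_codom (g : 'I_n -> 'I_n.+1) :
    (forall a b : 'I_n, (a < b)%N -> (g a < g b)%N) ->
    sorted ltn [seq val k | k <- codom g].
  move=> g_lt; rewrite -map_comp sorted_map.
  apply: (@sub_sorted _ (relpre val ltn)) => [a b /g_lt //|].
  by rewrite -sorted_map val_enum_ord iota_ltn_sorted.
have codomE (g : 'I_n -> 'I_n.+1) : injective g -> i \notin codom g ->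
    codom g =i predC1 i.
  move=> g_inj gi; apply/subset_cardP.
    by rewrite card_codom // cardC1 !card_ord.
  by apply/subsetP=> k kg; rewrite !inE; apply: contraNneq gi => <-.
have ci : i \notin codom (lift i).
  by apply/codomP=> -[k /eqP]; apply/negP; exact: neq_lift.
have s12 : s1 = s2.
  apply: (irr_sorted_eq ltn_trans ltnn); try exact: sorted_codom.
    by apply: sorted_codom => a b ab /=; rewrite ltnNge leq_bump2 -ltnNge.
  apply: eq_mem_map => k.
  by rewrite (codomE _ f_inj fi) (codomE _ (@lift_inj _ i) ci).
have nthE (g : 'I_n -> 'I_n.+1) : nth 0%N [seq val k | k <- codom g] j = g j.
  by rewrite (nth_map (g j)) ?size_codom ?card_ord // (nth_map j)
    ?size_enum_ord // nth_ord_enum.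
by have := nthE (lift i); rewrite -/s2 -s12 nthE => e; apply: val_inj.
Qed.

(** Up to sign, the minors of order [n] are the cofactors, that is, the entries of the adjugate. *)
Lemma dvdn_determinantal_divisor n (M : 'M[int]_n.+1) k :
  (k %| determinantal_divisor n M)%N <-> forall i j, (k %| `|(\adj M) i j|)%N.
Proof.
have adjE i j : `|(\adj M) i j|%N =
    `|\det (mxsub [ffun k : 'I_n => lift j k] [ffun k : 'I_n => lift i k] M)|%N.
  rewrite mxE /cofactor abszM abszX abszN1 exp1n mul1n; congr (`|\det _|)%N.
  by apply/matrixP=> a b; rewrite !mxE !ffunE.
split=> [/dvdn_biggcdP kd i j|kd].
  rewrite adjE; have /dvdn_biggcdP := kd _ (increasing_lift j).
  by apply; exact: increasing_lift.
apply/dvdn_biggcdP=> f /increasingP[j ->].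
apply/dvdn_biggcdP=> g /increasingP[i ->].
by rewrite -adjE.
Qed.

Lemma dvdn_gcd_vec n (v : 'cV[int]_n) k :
  (k %| gcd_vec v)%N <-> forall i, (k %| `|v i 0%R|)%N.
Proof.
split=> [/dvdn_biggcdP kv i|kv]; first exact: kv.
by apply/dvdn_biggcdP=> i _; exact: kv.
Qed.

(** For fixed [k] this turns [m %| k * a] into divisibility of [a] by a constant, a form that passes
    to a gcd of many values [a]. *)
Lemma dvdn_mul_gcd m k a : (0 < m)%N -> (m %| k * a)%N = (m %/ gcdn m k %| a)%N.
Proof.
move=> m0; set g := gcdn m k; have g0 : (0 < g)%N by rewrite gcdn_gt0 m0.
have gm : (m %/ g * g = m)%N by rewrite divnK ?dvdn_gcdl.
have gk : (k %/ g * g = k)%N by rewrite divnK ?dvdn_gcdr.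
rewrite -{1}gm -{1}gk mulnAC dvdn_pmul2r // Gauss_dvdr //.
by rewrite /coprime -(eqn_pmul2r g0) mul1n muln_gcdl gm gk.
Qed.

(** The right-hand side says that [g] has order exactly 2 modulo [m]; this is how the gcd conditions
    in (b) and (c) are read. *)
Lemma double_gcdn m g : (0 < m)%N ->
  (m = 2 * gcdn m g)%N <-> (m %| 2 * g)%N /\ ~ (m %| g)%N.
Proof.
move=> m0; have -> : (m %| 2 * g)%N = (m %| 2 * gcdn m g)%N.
  by rewrite muln_gcdr dvdn_gcd [X in _ = X && _]dvdn_mull.
have -> : (m %| g)%N = (gcdn m g == m) by apply/idP/eqP=> /gcdn_idPl.
have : (gcdn m g %| m)%N := dvdn_gcdl m g.
move: (gcdn m g) => h /dvdnP[q e'].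
split=> [e|[/dvdnP[c e] /eqP hm]].
  by split; [rewrite -e | move/eqP; lia].
have h0 : (0 < h)%N by case: h e' {e hm} => // e'; lia.
have /eqP : (2 * h = c * q * h)%N by rewrite e e' mulnA.
rewrite eqn_pmul2r // => /eqP qc.
have : (q <= 2)%N by apply: dvdn_leq => //; rewrite qc dvdn_mull.
by move: q qc e' => [|[|[|//]]] qc e' _; lia.
Qed.

Lemma scaled_invmx_adj n (M : 'M[int]_n) : \det M != 0 ->
  scaled_invmx M = sgz (\det M) *: \adj M.
Proof.
move=> dM; have /matrixP e : map_mx intr (scaled_invmx M) =
    map_mx intr (sgz (\det M) *: \adj M) :> 'M[rat]_n.
  rewrite scaled_invmxE // /invmx unitmxE det_map_mx unitfE intr_eq0 dM scalerA.
  rewrite -map_mx_adj map_mxZ; congr (_ *: _).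
  by rewrite -abszE abszEsg intrM -mulrA divff ?mulr1 ?intr_eq0.
by apply/matrixP=> i j; have := e i j; rewrite !mxE => /intr_inj.
Qed.

Lemma unitmx_absz_det n (L : 'M[int]_n) : L \in unitmx -> `|\det L|%N = 1%N.
Proof.
move=> /mulmxV /(congr1 (fun A => `|\det A|%N)); rewrite det_mulmx abszM det1.
by move/eqP; rewrite muln_eq1 => /andP[/eqP].
Qed.

(** Write [M = L D R] in Smith normal form. As [R] is unimodular, [v] lies in the lattice iff
    [invmx L *m v] lies in that of the diagonal matrix [D]. *)
Lemma smith_lattice n (M : 'M[int]_n.+1) : \det M != 0 ->
  exists (L : 'M[int]_n.+1) (e : 'I_n.+1 -> int),
    [/\ L \in unitmx, forall i, (e i %| e ord_max)%Z,
        `|\det M|%N = (\prod_i `|e i|)%N &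
        forall v : 'cV[int]_n.+1, (exists w, v = M *m w) <->
          (forall i, (e i %| (invmx L *m v) i 0%R)%Z)].
Proof.
move=> detM; have [L Lu [R Ru [s s_sorted ME]]] := int_Smith_normal_form M.
pose e (i : 'I_n.+1) := s`_i.
have {}ME : M = L *m diag_mx (\row_i e i) *m R.
  by rewrite ME; congr (_ *m _ *m _); apply/matrixP=> i j; rewrite !mxE val_eqE.
have detE : `|\det M|%N = (\prod_i `|e i|)%N.
  rewrite ME !det_mulmx !abszM (unitmx_absz_det Lu) (unitmx_absz_det Ru).
  rewrite mul1n muln1 det_diag.
  by elim/big_rec2: _ => // i a b _ <-; rewrite abszM mxE.
exists L, e; split=> // [i|v].
  have [lt_n|le_n] := ltnP n (size s); last first.
    (* Past the end of [s] the default entry is 0, which everything divides. *)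
    by rewrite /e /= (nth_default _ le_n) dvdz0.
  apply: (sorted_leq_nth (@dvdz_trans) (@dvdzz)) => //; rewrite ?inE -1?ltnS //.
  exact: leq_ltn_trans (leq_ord i) lt_n.
split=> [[w ->] i|ev].
  rewrite ME !mulmxA mulVmx // mul1mx -mulmxA mul_diag_mx !mxE; exact: dvdz_mulr.
exists (invmx R *m \col_i ((invmx L *m v) i 0%R %/ e i)%Z).
rewrite ME !mulmxA -[_ *m R *m _]mulmxA mulmxV // mulmx1 -mulmxA.
rewrite -[LHS](mulKVmx Lu); move: (invmx L *m v) ev => p ep; congr (_ *m _).
by apply/colP=> i; rewrite mul_diag_mx !mxE mulrC divzK.
Qed.

Lemma dvdn_subz_eq (a b e : nat) : (a < e)%N -> (b < e)%N ->
  (e %| `|(a%:Z - b%:Z)%R|)%N -> a = b.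
Proof.
move=> ae be h; have [|pos] := posnP `|(a%:Z - b%:Z)%R|%N; first lia.
by have := dvdn_leq pos h; lia.
Qed.

(** * Exponent, order and cyclicity of the quotient *)

Section LatticeQuotient.
Variables (n : nat) (M : 'M[int]_n.+1).
Hypothesis detM : \det M != 0.
Let V : zmodType := Quotient.quot (lattice M).
Let cl : 'cV[int]_n.+1 -> V := lattice_class M.
Let m := `|\det M|%N.
Let d := determinantal_divisor n M.

Let m_gt0 : (0 < m)%N. Proof. by rewrite absz_gt0. Qed.

Lemma lattice_class_surj (v : V) : exists u, v = lattice_class M u.
Proof. by exists (repr v); rewrite /lattice_class reprK. Qed.

Let clMn (u : 'cV[int]_n.+1) k : cl (u *+ k) = cl u *+ k.
Proof. by rewrite /cl /lattice_class raddfMn. Qed.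

Let cl_eq u v : cl u = cl v <-> exists w, u - v = M *m w.
Proof.
split=> [/eqP|uv].
  by rewrite /cl /lattice_class -Quotient.idealrBE => /asboolP.
by apply/eqP; rewrite /cl /lattice_class -Quotient.idealrBE; apply/asboolP.
Qed.

Let cl_eq0 u : cl u = 0 <-> exists w, u = M *m w.
Proof.
have -> : 0 = cl 0 by rewrite /cl /lattice_class raddf0.
by rewrite cl_eq subr0.
Qed.

(** By Cramer's rule, [u *+ k] lies in the lattice iff [\det M] divides all entries of
    [\adj M *m (u *+ k)]. *)
Let cl_mulrn_eq0 u k : cl u *+ k = 0 <-> (m %| k * gcd_vec (\adj M *m u))%N.
Proof.
rewrite -clMn cl_eq0 dvdn_mul_gcd // dvdn_gcd_vec.
have dvdE a : (m %/ gcdn m k %| `|a|)%N = (\det M %| a *+ k)%Z.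
  by rewrite -dvdn_mul_gcd // dvdzE -mulr_natl abszM natz.
have adjMn : \adj M *m (u *+ k) = (\adj M *m u) *+ k by rewrite raddfMn.
split=> [[w e] i|kadj].
  rewrite dvdE -mulmxnE -adjMn e mulmxA mul_adj_mx mul_scalar_mx mxE.
  exact: dvdz_mulr.
pose w := \col_i (((\adj M *m u) i 0%R *+ k)%R %/ \det M)%Z.
have adjw : \adj M *m (u *+ k) = \det M *: w.
  apply/colP=> i; rewrite adjMn mulmxnE [RHS]mxE [w i 0]mxE mulrC divzK //.
  by rewrite -dvdE.
exists w; apply/colP=> i; apply: (mulfI detM).
have /(congr1 (mulmx M)) := adjw.
rewrite mulmxA mul_mx_adj mul_scalar_mx -scalemxAr => /colP/(_ i).
by rewrite [LHS]mxE => ->; rewrite mxE.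
Qed.

(** It suffices to test the unit vectors, which [\adj M] sends to its columns; the gcd of all its
    entries is [d]. *)
Lemma lattice_quotient_exponent k :
  (forall v : V, v *+ k = 0) <-> (m %| k * d)%N.
Proof.
rewrite dvdn_mul_gcd // dvdn_determinantal_divisor.
split=> [Vk i j|kadj v].
  have := Vk (cl (delta_mx j 0)); rewrite cl_mulrn_eq0 dvdn_mul_gcd // dvdn_gcd_vec.
  by move=> /(_ i); rewrite -colE mxE.
have [u ->] := lattice_class_surj v; rewrite -/(cl u) cl_mulrn_eq0 dvdn_mul_gcd //.
apply/dvdn_gcd_vec=> i.
suff : (Posz (m %/ gcdn m k) %| (\adj M *m u) i 0%R)%Z by rewrite dvdzE.
rewrite mxE; apply: rpred_sum => j _; apply: dvdz_mulr; rewrite dvdzE; exact: kadj.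
Qed.

(** The determinant is an integer combination of entries of the adjugate. *)
Lemma divisor_dvd_det : (d %| m)%N.
Proof.
have /(congr1 (fun A : 'M_n.+1 => A 0 0)) := mul_mx_adj M.
rewrite mxE [RHS]mxE eqxx mulr1n => e.
suff : (Posz d %| \det M)%Z by rewrite dvdzE.
rewrite -e; apply: rpred_sum => j _; apply: dvdz_mull; rewrite dvdzE /=.
by apply: (dvdn_determinantal_divisor M d).1; rewrite dvdnn.
Qed.

Lemma involution_gcd u :
  (m = 2 * gcdn m (gcd_vec (scaled_invmx M *m u)))%N <->
  cl u + cl u = 0 /\ cl u <> 0.
Proof.
have -> : gcdn m (gcd_vec (scaled_invmx M *m u)) =
    gcdn m (gcd_vec (\adj M *m u)).
  congr gcdn; apply: eq_bigr => i _.
  by rewrite scaled_invmx_adj // -scalemxAl mxE abszM absz_sg detM mul1n.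
set g := gcd_vec _; have := cl_mulrn_eq0 u 1; have := cl_mulrn_eq0 u 2.
rewrite mulr2n mulr1n mul1n => -> ->.
exact: double_gcdn.
Qed.

(** In the coordinates given by [L], each class has a unique representative with [i]-th coordinate
    in the range from 0 to [|e i| - 1]. *)
Lemma lattice_quotient_card : exists f : 'I_m -> V, bijective f.
Proof.
have [L [e [Lu e_last detE latE]]] := smith_lattice detM.
have e0 i : (0 < `|e i|)%N.
  by move: m_gt0; rewrite /m detE (bigD1 i) //= muln_gt0 => /andP[].
pose T := {dffun forall i : 'I_n.+1, 'I_(`|e i|)}.
have cardT : #|T| = m.
  rewrite card_dep_ffun foldrE big_image /m detE.
  by apply: eq_bigr => i _; rewrite card_ord.
pose f (c : T) : V := cl (L *m \col_i (c i)%:Z).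
have f_inj : injective f.
  move=> c c' /cl_eq; rewrite -mulmxBr => /latE; rewrite mulKmx // => h.
  apply/ffunP=> i; apply: val_inj; have := h i; rewrite !mxE.
  exact: dvdn_subz_eq (ltn_ord _) (ltn_ord _).
have f_surj v : exists c, f c = v.
  have [u ->] := lattice_class_surj v.
  have [p pE] : exists p, invmx L *m u = p by exists (invmx L *m u).
  have lt i : (`|(p i 0%R %% e i)%Z| < `|e i|)%N.
    have ei : e i != 0 by rewrite -absz_gt0.
    by rewrite -ltz_nat gez0_abs ?modz_ge0 // abszE ltz_mod.
  exists [ffun i => Ordinal (lt i)]; apply/cl_eq/latE=> i.
  rewrite mulmxBr mulKmx // pE !mxE ffunE /=.
  have ei : e i != 0 by rewrite -absz_gt0.
  by rewrite gez0_abs ?modz_ge0 // -eqz_mod_dvd modz_mod.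
have f_bij := inj_surj_bij f_inj f_surj.
rewrite -cardT; exists (f \o enum_val); apply: bij_comp => //.
exact: enum_val_bij.
Qed.

(** The last invariant factor kills the quotient, so for [d = 1] it is a multiple of [m], the
    product of all of them up to sign. The others are therefore units. *)
Lemma divisor1_cyclic : d = 1%N -> cyclic_zmod V.
Proof.
have [L [e [Lu e_last detE latE]]] := smith_lattice detM.
move=> d1; have : (m %| `|e ord_max|%N * d)%N.
  apply/lattice_quotient_exponent=> v; have [u ->] := lattice_class_surj v.
  rewrite -/(cl u) -clMn; apply/cl_eq0/latE=> i.
  rewrite raddfMn mulmxnE -mulr_natl.
  by apply: dvdz_mulr; rewrite natz dvdzE absz_nat -dvdzE; apply: e_last.
rewrite d1 muln1 => m_dvd.
have e1 i : i != ord_max -> `|e i|%N = 1%N.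
  move=> i_max; move: m_dvd; rewrite /m detE (bigD1 ord_max) //= => /dvdnP[q].
  have := m_gt0; rewrite /m detE (bigD1 ord_max) //= (bigD1 i) //=.
  set E := `|e ord_max|%N; set F := `|e i|%N; set r := (\prod_(_ | _) _)%N.
  rewrite muln_gt0 => /andP[E0 _] /eqP; rewrite mulnCA -{1}[E]muln1 eqn_pmul2l //.
  by rewrite eq_sym !muln_eq1 => /and3P[_ /eqP].
(* The coordinates other than the last only matter modulo 1, so the last basis vector generates. *)
exists (cl (L *m delta_mx ord_max 0)) => v.
have [u ->] := lattice_class_surj v.
exists ((invmx L *m u) ord_max 0%R).
have clMz (a : 'cV[int]_n.+1) (k : int) : cl a *~ k = cl (k *: a).
  by rewrite -[k in RHS]intz scaler_int /cl /lattice_class raddfMz.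
rewrite clMz; apply/cl_eq/latE=> i.
rewrite mulmxBr -scalemxAr mulKmx // !mxE.
have [->|ne] := eqVneq i ord_max; first by rewrite eqxx /= mulr1 subrr dvdz0.
by rewrite dvdzE e1 // dvd1n.
Qed.

End LatticeQuotient.

Theorem theorem3p5 (n : nat) (M : 'M[int]_n) (a1 a2 : 'cV[int]_n) :
  (0 < n)%N ->
  \det M != 0 ->
  let d := determinantal_divisor n.-1 M in
  let m := `|\det M|%N in
  let A := [:: lattice_class M a1; lattice_class M a2] in
  generates (mem A) ->
  let a := d = 1%N in
  let b := d = 2%N /\
    m = (2 * gcdn m (gcd_vec (scaled_invmx M *m (a1 - a2))))%N in
  let c := d = 2%N /\
    m = (2 * gcdn m (gcd_vec (scaled_invmx M *m (a1 + a2))))%N in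
  (is_circulant (cayley (mem A)) <-> a \/ b) /\
  (is_circulant (cayley (symmetrize (mem A))) <-> [\/ a, b | c]).
Proof.
case: n M a1 a2 => // n M a1 a2 _ detM d m A genA a b c.
have m_gt0 : (0 < m)%N by rewrite absz_gt0.
have d1_cyclic := @divisor1_cyclic n M detM.
have cardV := lattice_quotient_card detM.
have expV := lattice_quotient_exponent detM.
have d_dvd := divisor_dvd_det M.
have bE : b <-> d = 2%N /\ lattice_class M a1 - lattice_class M a2 +
    (lattice_class M a1 - lattice_class M a2) = 0 /\
    lattice_class M a1 - lattice_class M a2 <> 0.
  by rewrite /b (involution_gcd detM) /lattice_class raddfB.
have cE : c <-> d = 2%N /\ lattice_class M a1 + lattice_class M a2 +
    (lattice_class M a1 + lattice_class M a2) = 0 /\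
    lattice_class M a1 + lattice_class M a2 <> 0.
  by rewrite /c (involution_gcd detM) /lattice_class raddfD.
split.
  apply: iff_trans (two_step_circulant m_gt0 genA cardV d_dvd expV d1_cyclic) _.
  by split=> -[?|/bE ?]; [left | right | left | right].
apply: iff_trans (symmetric_circulant m_gt0 genA cardV d_dvd expV d1_cyclic) _.
by split=> -[?|/bE ?|/cE ?];
  [exact: Or31 | exact: Or32 | exact: Or33
  |exact: Or31 | exact: Or32 | exact: Or33].
Qed.
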